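(* Let $G$ be a countable group. If $G$ has an effective minimal non-elementary convergence group action, then $G$ is a Powers group.
   Context: Convergence group action: Let $G$ be a countable group, $X$ a compact metrizable space and $\rho:G\to \mathrm{Homeo}(X)$ a homomorphism. The pair $(\rho,X)$ is a convergence group action of $G$ if $X$ has at least three points and, for any infinite sequence $\{g_i\}$ of mutually different elements of $G$, there exist a subsequence $\{g_{i_j}\}$ and two (possibly equal) points $r,a\in X$ such that $\rho(g_{i_j})|_{X\setminus\{r\}}$ converges to (the constant map) $a$ uniformly on compact subsets of $X\setminus\{r\}$ and $\rho(g_{i_j}^{-1})|_{X\setminus\{a\}}$ converges to $r$ uniformly on compact subsets of $X\setminus\{a\}$. Such a sequence $\{g_{i_j}\}$ is called a convergence sequence, with repelling point $r$ and attracting point $a$. The limit set $\Lambda(\rho)\subset X$ is the set of all repelling points and attracting points of convergence sequences of $(\rho,X)$. The action is non-elementary if $\Lambda(\rho)$ is infinite. It is minimal if every $\rho(G)$-orbit is dense in $X$, and effective if $\rho$ is injective. Powers group: A group $G$ is a Powers group if $G\neq\{1\}$ and, for every finite subset $F\subset G\setminus\{1\}$ and every integer $N\ge 1$, there exist a partition $G=C\sqcup D$ and elements $\gamma_1,\dots,\gamma_N\in G$ such that $fC\cap C=\emptyset$ for all $f\in F$ and $\gamma_jD\cap\gamma_kD=\emptyset$ for all $j\neq k$ in $\{1,\dots,N\}$. *)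

(* Defs.v *)
From HB Require Import structures.
From mathcomp Require Import all_boot all_order all_algebra.
From mathcomp Require Import all_classical all_reals all_analysis.

Set Implicit Arguments.
Unset Strict Implicit.
Unset Printing Implicit Defensive.

Local Open Scope classical_set_scope.
Local Open Scope group_scope.

Record homeo (X : topologicalType) := Homeo {
  homeo_fun :> X -> X;
  homeo_inv : X -> X;
  homeo_funK : cancel homeo_fun homeo_inv;
  homeo_invK : cancel homeo_inv homeo_fun;
  homeo_continuous : continuous homeo_fun;
  homeo_inv_continuous : continuous homeo_inv
}.

Section HomeoGroup.
Variable X : topologicalType.
Implicit Types f g h : homeo X.

Lemma homeoP f g : (f : X -> X) =1 g -> f = g.
Proof.
case: f g => [f f' fK f'K fc f'c] [g g' gK g'K gc g'c] /= /funext fg.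
subst g; have fg' : f' = g'.
  by apply/funext => x; rewrite -[in RHS](f'K x) gK.
by subst g'; congr Homeo; exact: Prop_irrelevance.
Qed.

Lemma homeo_id_continuous : continuous (id : X -> X).
Proof. by move=> x; exact: cvg_id. Qed.

Definition homeo_one : homeo X :=
  @Homeo X id id (fun=> erefl) (fun=> erefl)
    homeo_id_continuous homeo_id_continuous.

Definition homeo_opp f : homeo X :=
  Homeo (@homeo_invK X f) (@homeo_funK X f)
    (@homeo_inv_continuous X f) (@homeo_continuous X f).

Lemma homeo_comp_continuous (u v : X -> X) :
  continuous u -> continuous v -> continuous (u \o v).
Proof. by move=> uc vc x; apply: continuous_comp; [exact: vc|exact: uc]. Qed.

Definition homeo_mul f g : homeo X :=
  Homeo (can_comp (@homeo_funK X f) (@homeo_funK X g))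
    (can_comp (@homeo_invK X g) (@homeo_invK X f))
    (homeo_comp_continuous (@homeo_continuous X f) (@homeo_continuous X g))
    (homeo_comp_continuous (@homeo_inv_continuous X g)
       (@homeo_inv_continuous X f)).

HB.instance Definition _ := gen_eqMixin (homeo X).
HB.instance Definition _ := gen_choiceMixin (homeo X).

Lemma homeo_mulA : associative homeo_mul.
Proof. by move=> f g h; exact: homeoP. Qed.

Lemma homeo_mul1 : left_id homeo_one homeo_mul.
Proof. by move=> f; exact: homeoP. Qed.

Lemma homeo_mulr1 : right_id homeo_one homeo_mul.
Proof. by move=> f; exact: homeoP. Qed.

Lemma homeo_mulV : left_inverse homeo_one homeo_opp homeo_mul.
Proof. by move=> f; apply: homeoP => x; exact: homeo_funK. Qed.

Lemma homeo_mulrV : right_inverse homeo_one homeo_opp homeo_mul.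
Proof. by move=> f; apply: homeoP => x; exact: homeo_invK. Qed.

HB.instance Definition _ := isGroup.Build (homeo X)
  homeo_mulA homeo_mul1 homeo_mulr1 homeo_mulV homeo_mulrV.

End HomeoGroup.

Section ConvergenceAction.
Variables (R : realType) (G : groupType) (X : metricType R).
Variable rho : {multiplicative G -> homeo X}.

Definition cvg_cst_off (u : nat -> homeo X) (p q : X) : Prop :=
  {family (fun K => compact K /\ K `<=` ~` [set p]),
    (fun n => (u n : X -> X)) @ \oo --> (cst q : X -> X)}.

Definition convergence_sequence (g : nat -> G) (r a : X) : Prop :=
  [/\ injective g,
      cvg_cst_off (fun n => rho (g n)) r a &
      cvg_cst_off (fun n => rho ((g n)^-1)) a r].

Definition convergence_action : Prop :=
  (exists x y z : X, [/\ x <> y, y <> z & x <> z]) /\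
  forall g : nat -> G, injective g ->
    exists (i : nat -> nat) (r a : X),
      {homo i : m n / (m < n)%N} /\ convergence_sequence (g \o i) r a.

Definition limit_set : set X :=
  [set x | exists (g : nat -> G) (r a : X),
     convergence_sequence g r a /\ (x = r \/ x = a)].

Definition non_elementary : Prop := infinite_set limit_set.

Definition minimal_action : Prop :=
  forall x : X, dense (range (fun g : G => rho g x)).

Definition effective_action : Prop := injective rho.

End ConvergenceAction.

(* The blocks [C] and [D] of the partition are allowed to be empty. *)
Definition powers_group (G : groupType) : Prop :=
  (exists g : G, g <> 1) /\
  forall (F : set G) (N : nat),
    finite_set F -> F `<=` ~` [set 1] -> (1 <= N)%N ->
    exists (C D : set G) (gamma : 'I_N -> G),
      [/\ C `|` D = [set: G], C `&` D = set0,
          forall f, F f -> [set f * x | x in C] `&` C = set0 &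
          forall j k, j <> k ->
            [set gamma j * x | x in D] `&` [set gamma k * x | x in D] = set0].

(* Main.v *)
Require Import Defs.
From mathcomp Require Import all_boot all_order all_algebra.
From mathcomp Require Import all_classical all_reals all_analysis.

Local Open Scope classical_set_scope.

(** For every nonempty open subset [U] of [X], minimality moves the repelling
point of some convergence sequence into [U], so there are [g n] in [G] and a
point [a] such that the sets [g n (X \ U)] shrink to [a].

If a nontrivial [f] fixed such a [U] pointwise, the conjugates
[g n * f * (g n)^-1] would fix larger and larger parts of [X \ {a}]. They cannot
take infinitely many values, since a convergence subsequence would move almost
every point; hence one value is taken infinitely often, it is the identity, and
[f = 1] by effectiveness. So fixed-point sets of nontrivial elements have empty
interior, and for every finite [F] avoiding [1] there is a nonempty open [V]
with [f V] disjoint from [V] for all [f] in [F].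

Put [C = {g | g x0 in V}] and let [D] be its complement. If the points [k j a]
are distinct, then for [n] large the sets [k j (g n (X \ V))] are pairwise
disjoint, where [g] contracts [X \ V] to [a], so [gamma j = k j * g n] works. *)

Lemma infinite_set_inj_seq (T : Type) (A : set T) : infinite_set A ->
  exists2 e : nat -> T, injective e & forall n, A (e n).
Proof.
elim/Ppointed: T => T in A *.
  by move=> /infinite_setN0[x]; have := no x.
move=> /infiniteP/pcard_leP[e]; exists e => [m n|n].
  by apply: (@inj _ _ _ e); rewrite inE.
exact: (@funS _ _ _ _ e).
Qed.

(** Pigeonhole: finitely many finite fibres cannot cover [nat]. The reindexing [j] is only
    injective, since it merely picks preimages of distinct values. *)
Lemma inj_subseq_or_recurrent (T : Type) (f : nat -> T) :
  (exists2 j : nat -> nat, injective j & injective (f \o j)) \/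
  (exists v, infinite_set (f @^-1` [set v])).
Proof.
have [fin|inf] := pselect (finite_set (range f)); [right|left].
  apply: contrapT => /forallNP fib; apply: infinite_nat.
  apply: (@sub_finite_set _ _ (\bigcup_(v in range f) f @^-1` [set v])).
    by move=> n _; exists (f n) => //; exists n.
  by apply: bigcup_finite => // v _; apply: contrapT; exact: fib.
have [e einj er] := @infinite_set_inj_seq _ _ inf.
have /choice[j jE] : forall n, exists m, f m = e n.
  by move=> n; have [m _ <-] := er n; exists m.
exists j => m n; last by rewrite /= !jE => /einj.
by move=> jmn; apply: einj; rewrite -!jE jmn.
Qed.

Lemma infinite_nat_unbounded (A : set nat) (M : nat) :
  infinite_set A -> exists2 n, A n & (M <= n)%N.
Proof.
move=> inf; apply: contrapT => nex; apply: inf.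
apply: (@sub_finite_set _ _ `I_M); last exact: finite_II.
move=> n An /=; rewrite ltnNge; apply/negP => Mn.
by apply: nex; exists n.
Qed.

Lemma cvg_cst_off_near (R : realType) (X : metricType R) (u : nat -> homeo X)
    (p q : X) (K V : set X) :
  cvg_cst_off u p q -> compact K -> ~ K p -> nbhs q V ->
  \forall n \near \oo, forall x, K x -> V (u n x).
Proof.
move=> /fam_cvgP ucvg Kc Kp /nbhsP[E entE EV].
have KP : compact K /\ K `<=` ~` [set p].
  by split=> // x Kx xp; apply: Kp; rewrite -xp.
apply: (ucvg K KP [set h : X -> X | forall y, K y -> V (h y)]).
apply/uniform_nbhs; exists E; split => // h hE y Ky.
by apply: EV; apply/xsectionP; exact: hE.
Qed.

Lemma metric_separation (R : realType) (X : metricType R) (x y : X) :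
  x <> y -> exists A B : set X, [/\ nbhs x A, nbhs y B & A `&` B = set0].
Proof.
move=> /eqP xy; have := @metric_hausdorff R X; rewrite open_hausdorff.
move=> /(_ _ _ xy)[[A B] /= [/set_mem Ax /set_mem By] [oA oB /eqP AB]].
by exists A, B; split => //; exact: open_nbhs_nbhs.
Qed.

Lemma metric_finite_closed (R : realType) (X : metricType R) (A : set X) :
  finite_set A -> closed A.
Proof.
apply: (iffLR accessible_finite_set_closed).
exact/hausdorff_accessible/metric_hausdorff.
Qed.

Lemma nbhs_setC1 (R : realType) (X : metricType R) (x y : X) :
  x <> y -> nbhs x (~` [set y]).
Proof.
move=> xy; apply: open_nbhs_nbhs; split => //.
by apply: closed_openC; apply: metric_finite_closed; exact: finite_set1.
Qed.

Section Action.
Variables (R : realType) (G : groupType) (X : metricType R).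
Variable rho : {multiplicative G -> homeo X}.

Lemma actM (g h : G) (x : X) : rho (g * h)%g x = rho g (rho h x).
Proof. by rewrite gmulfM. Qed.

Lemma act_inj (g : G) : injective (rho g).
Proof. exact: can_inj (@homeo_funK _ (rho g)). Qed.

Lemma act1 (x : X) : rho 1%g x = x.
Proof. by apply: (@act_inj 1%g); rewrite -actM mulg1. Qed.

Lemma actKV (g : G) (x : X) : rho g (rho g^-1%g x) = x.
Proof. by rewrite -actM mulgV act1. Qed.

Lemma nbhs_act_preimage (g : G) (x : X) (V : set X) :
  nbhs (rho g x) V -> nbhs x (rho g @^-1` V).
Proof. exact: (@homeo_continuous _ (rho g) x). Qed.

Lemma open_act_preimage (g : G) (V : set X) : open V -> open (rho g @^-1` V).
Proof. by apply: open_comp => x _; exact: homeo_continuous. Qed.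

Hypothesis X_compact : compact [set: X].
Hypothesis rho_minimal : minimal_action rho.
Hypothesis rho_non_elementary : non_elementary rho.

Lemma infinite_space : infinite_set [set: X].
Proof. by apply: contra_not rho_non_elementary; exact: sub_finite_set. Qed.

(** A finite orbit is closed as well as dense, so it would exhaust the infinite space. *)
Lemma infinite_orbit (x : X) : infinite_set (range (fun g : G => rho g x)).
Proof.
move=> fin; apply: infinite_space; apply: (sub_finite_set _ fin) => y _.
apply: contrapT => ny.
have [|| z [nz]] := @rho_minimal x (~` range (fun g : G => rho g x)).
- by exists y.
- by apply: closed_openC; exact: metric_finite_closed.
- exact: nz.
Qed.

Lemma contracting_sequence (U : set X) : open U -> U !=set0 ->
  exists (g : nat -> G) (a : X), forall V, nbhs a V ->
    \forall n \near \oo, forall x, ~ U x -> V (rho (g n) x).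
Proof.
move=> oU U0.
have [_ [g [r [a [[_ gra _] _]]]]] := infinite_setN0 rho_non_elementary.
have [y [Uhr [h _ hr]]] := rho_minimal r U U0 oU; rewrite -{y}hr in Uhr.
(* Precomposing with [h^-1] moves the repelling point from [r] to [rho h r], which lies in [U]; so
   pulling the complement of [U] back by [h] gives a compact set missing [r]. *)
exists (fun n => g n * h^-1)%g, a => V aV.
have oU' := @open_act_preimage h U oU.
have K_compact : compact (~` (rho h @^-1` U)).
  exact: subclosed_compact (open_closedC oU') X_compact _.
have Kr : ~ (~` (rho h @^-1` U)) r by apply.
apply: filterS (cvg_cst_off_near _ _ _ _ _ _ _ gra K_compact Kr aV).
by move=> n gnV x Ux; rewrite actM; apply: gnV => /=; rewrite actKV.
Qed.

Hypothesis rho_convergence : convergence_action rho.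
Hypothesis rho_effective : effective_action rho.

Lemma fixed_open_trivial (U : set X) (f : G) : open U -> U !=set0 ->
  (forall x, U x -> rho f x = x) -> f = 1%g.
Proof.
move=> oU U0 fU; have [g [a ga]] := contracting_sequence U oU U0.
pose c n := (g n * f * (g n)^-1)%g.
(* Eventually [g n] sends the complement of [U] away from [x], so [(g n)^-1] sends [x] into [U],
   where [f] acts trivially. *)
have c_fix x : x <> a -> \forall n \near \oo, rho (c n) x = x.
  move=> xa; apply: filterS (ga (~` [set x]) _); last exact/nbhs_setC1/nesym.
  move=> n gnV; rewrite /c !actM fU ?actKV//.
  by apply: contrapT => /gnV; rewrite actKV; exact.
have [[j jinj cjinj]|[v v_inf]] := inj_subseq_or_recurrent _ c.
  have [i [r [b [imono [_ irb _]]]]] := (rho_convergence.2) _ cjinj.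
  have iinj : injective i.
    move=> m n imn; apply/eqP; case: ltngtP => // /imono; by rewrite imn ltnn.
  (* Such an [x] is eventually pushed towards [b], hence moved, yet [c_fix] makes it eventually
     fixed. *)
  have [x [xa xr xb]] : exists x, [/\ x <> a, x <> r & x <> b].
    apply: contrapT => nx; apply: infinite_space.
    apply: (@sub_finite_set _ _ [set a; r; b]); last first.
      by rewrite !finite_setU; do ?split; exact: finite_set1.
    move=> x _; apply: contrapT => nar; apply: nx; exists x.
    by split => xE; apply: nar; rewrite xE /=; tauto.
  have x_compact : compact [set x] by exact/finite_compact/finite_set1.
  have [M _ moves] := cvg_cst_off_near _ _ _ _ _ _ _ irb x_compact (nesym xr)
    (nbhs_setC1 _ _ _ _ (nesym xb)).
  have [M' _ fixes] := c_fix x xa.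
  (* As [j] need not be monotone, an index late enough for both [moves] and [fixes] is found by
     discarding finitely many [n]. *)
  have : infinite_set [set n | (M <= n)%N /\ (M' <= j (i n))%N].
    move=> fin; apply: infinite_nat.
    apply: (@sub_finite_set _ _ ([set n | (M <= n)%N /\ (M' <= j (i n))%N]
      `|` (`I_M `|` (j \o i) @^-1` `I_M'))).
      move=> n _ /=; case: (ltnP n M) => [|Mn]; first by right; left.
      by case: (ltnP (j (i n)) M') => [|Mn']; [right; right|left].
    rewrite !finite_setU; split => //; split; first exact: finite_II.
    by apply: finite_preimage (finite_II _) => m n _ _ /jinj/iinj.
  move=> /infinite_setN0[n [Mn M'n]].
  by case: (moves n Mn x erefl); exact: fixes.
have v_fix x : x <> a -> rho v x = x.
  move=> xa; have [M _ fixes] := c_fix x xa.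
  by have [n <- Mn] := infinite_nat_unbounded _ M v_inf; exact: fixes.
have v1 : v = 1%g.
  apply: rho_effective; apply: homeoP => x; rewrite act1.
  have [xa|/v_fix//] := pselect (x = a).
  (* Were [a] moved, its image would be fixed by [v], and injectivity would give [rho v a = a]. *)
  apply: contrapT => vx; apply: (vx); apply: (act_inj v).
  by apply: v_fix; rewrite -xa.
have [n /= cn] := infinite_setN0 v_inf.
move: cn; rewrite v1 /c => /(congr1 (fun z => (g n)^-1 * z * g n)%g).
by rewrite !mulgA mulVg mul1g mulgVK mulg1 mulVg.
Qed.

Lemma displaced_open (s : seq G) : (forall f, f \in s -> f <> 1%g) ->
  exists V : set X, [/\ open V, V !=set0 &
    forall f, f \in s -> forall x, V x -> ~ V (rho f x)].
Proof.
elim: s => [_|f s IH s1].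
  by exists setT; split; [exact: openT|exact: infinite_setN0 infinite_space|].
have [|V [oV V0 Vs]] := IH.
  by move=> h hs; apply: s1; rewrite inE hs orbT.
have [x Vx fx] : exists2 x, V x & rho f x <> x.
  apply: contrapT => nx; apply: (s1 f); first exact: mem_head.
  apply: (fixed_open_trivial V f) => // x Vx.
  by apply: contrapT => fx; apply: nx; exists x.
have [A [B [fxA xB AB]]] := metric_separation _ _ _ _ fx.
(* Points of the new set lie in [B] and their images under [f] in [A], so none returns; shrinking
   [V] keeps the property for [s]. *)
exists (V `&` (rho f @^-1` A° `&` B°)); split.
- apply: openI => //; apply: openI; last exact: open_interior.
  by apply: open_act_preimage; exact: open_interior.
- by exists x.
- move=> h; rewrite inE => /orP[/eqP->|hs] y [Vy [fyA yB]].
    move=> [_ [_ fyB]]; suff : (A `&` B) (rho f y) by rewrite AB.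
    by split; exact: interior_subset.
  by move=> [Vhy _]; exact: Vs hs y Vy Vhy.
Qed.

Lemma disjoint_translates (U : set X) (N : nat) : open U -> U !=set0 ->
  exists gamma : 'I_N -> G, forall j k, j <> k ->
    forall x y, ~ U x -> ~ U y -> rho (gamma j) x <> rho (gamma k) y.
Proof.
move=> oU U0; have [g [a ga]] := contracting_sequence U oU U0.
have [e einj eorb] := infinite_set_inj_seq _ _ (infinite_orbit a).
have /choice[k kE] : forall n, exists h, rho h a = e n.
  by move=> n; have [h _ <-] := eorb n; exists h.
pose Q (ij : 'I_N * 'I_N) : set nat := [set n | ij.1 <> ij.2 ->
  forall x y, ~ U x -> ~ U y ->
  rho (k ij.1 * g n)%g x <> rho (k ij.2 * g n)%g y].
have : \forall n \near \oo, forall ij, Q ij n.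
  (* There are finitely many pairs of indices, so one [n] serves them all. *)
  apply: (@filter_forall _ _ Q \oo) => -[i j]; rewrite /Q /=.
  have [->|/eqP ij] := eqVneq i j; first by apply: nearW => n [].
  have [|A [B [iA jB AB]]] := @metric_separation _ _ (e i) (e j).
    by move=> /einj/val_inj.
  have aAB : nbhs a (rho (k i) @^-1` A `&` rho (k j) @^-1` B).
    by apply: filterI; apply: nbhs_act_preimage; rewrite kE.
  apply: filterS (ga _ aAB) => n gn _ x y Ux Uy; rewrite !actM => xy.
  suff : (A `&` B) (rho (k i) (rho (g n) x)) by rewrite AB.
  by split; [exact: (gn x Ux).1|rewrite xy; exact: (gn y Uy).2].
move=> /filter_ex[n H].
by exists (fun i : 'I_N => k i * g n)%g => i j; exact: (H (i, j)).
Qed.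

End Action.

Theorem theorem1p1 (R : realType) (G : groupType) (X : metricType R)
    (rho : {multiplicative G -> homeo X})
    (G_countable : countable [set: G])
    (X_compact : compact [set: X])
    (rho_convergence : convergence_action rho)
    (rho_effective : effective_action rho)
    (rho_minimal : minimal_action rho)
    (rho_non_elementary : non_elementary rho) :
  powers_group G.
Proof.
split.
  have [_ [g [_ [_ [[ginj _ _] _]]]]] := infinite_setN0 rho_non_elementary.
  (* [g] is injective, so [g 0] and [g 1] are not both trivial. *)
  have [g0|] := pselect (g 0%N = 1%g); last by exists (g 0%N).
  by exists (g 1%N); rewrite -g0 => /ginj.
move=> F N /finite_seqP[s ->] s1 _.
have [|V [oV V0 Vs]] := displaced_open R G X rho X_compact rho_minimal
  rho_non_elementary rho_convergence rho_effective s.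
  by move=> f fs; exact: s1.
have [gamma gammaV] := disjoint_translates R G X rho X_compact rho_minimal
  rho_non_elementary V N oV V0.
have [x0 _] := V0.
exists [set g | V (rho g x0)], (~` [set g | V (rho g x0)]), gamma; split.
- exact: setUv.
- exact: setICr.
- move=> f fs; rewrite -subset0 => _ [[g /= Vg <-]] /=; rewrite actM.
  exact: Vs.
(* Applied to [x0], a common element of two translates would give a common point of the images of
   the complement of [V] under [gamma j] and [gamma k]. *)
- move=> j k jk; rewrite -subset0 => _ [[g /= Vg <-] [h /= Vh]] hg.
  by apply: (gammaV j k jk _ _ Vg Vh); rewrite -!actM hg.
Qed.
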